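(* Let $p,q,r\in\mathbb{Z}$ and let $\Delta_{p,q,r}=\{x+iy\in\mathbb{C} : x,y\in\mathbb{R},\ px+qy=r\}$. Then the intersection $\mathcal{K}\cap\Delta_{p,q,r}$ of the Knuth Twin Dragon $\mathcal{K}$ with $\Delta_{p,q,r}$ can be described by a Büchi automaton; that is, there is a Büchi automaton with alphabet $\mathcal{D}$ whose $\omega$-language is exactly the set of all sequences $b_1b_2b_3\cdots\in\mathcal{D}^{\omega}$ such that $$\sum_{k=1}^\infty\frac{b_k}{(-4)^k}\in\mathcal{K}\cap\Delta_{p,q,r}.$$
   Context: Let $\alpha=-1+i$. The Knuth Twin Dragon is $\mathcal{K}=\left\{\sum_{k=1}^\infty d_k\alpha^{-k} : d_k\in\{0,1\}\right\}\subset\mathbb{C}$. Since $\alpha^4=-4$, grouping digits in blocks of four gives $\mathcal{K}=\left\{\sum_{k=1}^\infty b_k(-4)^{-k} : b_k\in\mathcal{D}\right\}$, where $$\mathcal{D}=\left\{\sum_{j=0}^3 e_j\alpha^j : e_j\in\{0,1\}\right\}=\{-1-i,\,-1+i,\,-2i,\,-i,\,0,\,i,\,1-2i,\,1,\,1+i,\,1+3i,\,2,\,2+i,\,2+2i,\,2+3i,\,3,\,3+2i\}.$$ A Büchi automaton is a $5$-tuple $(Q,A,E,I,T)$, where $Q$ is a finite set of states, $A$ is a finite alphabet, $E\subset Q\times A\times Q$ is a set of edges, and $I,T\subset Q$ are the sets of initial and terminal states. A finite path $q_0\overset{w_1}{\to}q_1\overset{w_2}{\to}\cdots\overset{w_n}{\to}q_n$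 (with $(q_{k-1},w_k,q_k)\in E$ for all $k$) is successful if $q_0\in I$ and $q_n\in T$. An infinite path is successful if infinitely many of its initial finite subpaths (prefixes) are successful. An infinite word $w\in A^\omega$ is accepted if it is the label of a successful infinite path. The set of all accepted $w\in A^\omega$ is the $\omega$-language of the automaton. *)

(* Defs.v *)
From mathcomp Require Import all_boot all_order all_algebra finmap.
From mathcomp Require Import all_classical all_reals all_analysis.
From mathcomp Require Import complex.

Set Implicit Arguments.
Unset Strict Implicit.
Unset Printing Implicit Defensive.

Import Order.TTheory GRing.Theory Num.Theory numFieldNormedType.Exports.

Local Open Scope classical_set_scope.
Local Open Scope ring_scope.
Local Open Scope complex_scope.

Record buchi (A : finType) := Buchi {
  state : finType;
  edges : {set state * A * state};
  initial : {set state};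
  terminal : {set state} }.

(* A path is the sequence q of its states together with its label w; the
   letter read on the edge from q k to q k.+1 is w k, so that the informal
   word w_1 w_2 ... is indexed from 0 here. *)
Definition infinite_path (A : finType) (M : buchi A)
    (q : nat -> state M) (w : nat -> A) : Prop :=
  forall k, (q k, w k, q k.+1) \in edges M.

(* The prefix of length n of a path is successful. *)
Definition successful_prefix (A : finType) (M : buchi A)
    (q : nat -> state M) (n : nat) : Prop :=
  q 0%N \in initial M /\ q n \in terminal M.

Definition successful_path (A : finType) (M : buchi A)
    (q : nat -> state M) (w : nat -> A) : Prop :=
  infinite_path q w /\ infinite_set [set n | successful_prefix q n].

Definition omega_language (A : finType) (M : buchi A) : set (nat -> A) :=
  [set w | exists q : nat -> state M, successful_path q w].

(* Casting R[i] to numFieldType gives it the topology induced by its norm,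
   which is the usual modulus. *)
Definition C (R : realType) : numFieldType := R[i].

Definition alpha (R : realType) : C R := -1 +i* 1.

(* Infinite sums are indexed from 0: the term of index k has weight
   alpha^-(k+1). *)
Definition twin_dragon (R : realType) : set (C R) :=
  [set z | exists d : nat -> bool,
    series (fun k => (d k)%:R * alpha R ^- k.+1) @ \oo --> z].
Arguments twin_dragon : clear implicits.

Definition digits (R : realType) : {fset C R} :=
  [fset z in [seq \sum_(j < 4) (e j)%:R * alpha R ^+ j
             | e : {ffun 'I_4 -> bool}]]%fset.

Definition Delta (R : realType) (p q r : int) : set (C R) :=
  [set z | exists x y : R,
    z = x +i* y /\ p%:~R * x + q%:~R * y = r%:~R].
Arguments Delta : clear implicits.

Definition is_expansion (R : realType) (b : nat -> digits R) (z : C R) : Prop :=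
  series (fun k => val (b k) / (- 4%:R) ^+ k.+1) @ \oo --> z.

(* Main.v *)
Require Import Defs.
From mathcomp Require Import all_boot all_order all_algebra finmap.
From mathcomp Require Import all_classical all_reals all_analysis.
From mathcomp Require Import complex ring zify.

(** Put l(x + iy) = px + qy. The digits are Gaussian integers, so l maps the
    finite digit set into the integers of some interval [-N, N]. By linearity,
    a sequence b describes a point of the line exactly when
      r = l(b_0)/(-4) + l(b_1)/(-4)^2 + ...
    Reading this equation digit by digit produces integer remainders
      s_0 = r,   s_(n+1) = -4 s_n - l(b_n),
    and the n-th partial sum of the right-hand side is r - s_n / (-4)^n
    ([series_remainder]). If all remainders stay in [-N, N], the error term
    tends to 0. If instead some |s_m| exceeds N, then the recurrence makes the
    remainders grow like 4^n ([remainder_escape]) and the error term stays away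
    from 0. Hence the equation holds exactly when all remainders stay in
    [-N, N] ([cvg_series_remainder]): an automaton whose states are the
    integers of [-N, N], all of them terminal, checks this
    ([remainder_automatonP]).

    Membership in the twin dragon imposes no condition on b: replacing each
    base -4 digit by its four base alpha digits gives a dominated, hence
    convergent, series, and the base -4 partial sums are every fourth of its
    partial sums ([expansion_in_twin_dragon]). *)

Set Implicit Arguments.
Unset Strict Implicit.
Unset Printing Implicit Defensive.

Import Order.TTheory GRing.Theory Num.Theory numFieldNormedType.Exports.

Local Open Scope classical_set_scope.
Local Open Scope ring_scope.
Local Open Scope complex_scope.

(** * Convergence of complex sequences *)

(** [R[i]] has its norm in [R[i]], so bounds on real quantities are compared
    with it through the embedding of the reals. *)
Lemma cvg_additive_contraction (R : realType) (f : C R -> R) (u : nat -> C R)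
    (z : C R) :
  {morph f : v w / v - w} -> (forall w, `|f w|%:C <= `|w|) ->
  u @ \oo --> z -> (fun n => f (u n)) @ \oo --> (f z : R).
Proof.
move=> fB f1 /cvgrPdist_lt uz; apply/cvgrPdist_lt => /= e e0.
have e0' : 0 < (e%:C : C R) by rewrite ltcR.
apply: filterS (uz _ e0') => n; rewrite -ltcR -fB; apply: le_lt_trans.
exact: f1.
Qed.

Lemma normc_ge_Im (R : realType) (z : C R) : `|complex.Im z|%:C <= `|z|.
Proof. by rewrite normc_def lecR -sqrtr_sqr ler_wsqrtr// lerDr sqr_ge0. Qed.

Lemma cvg_Re (R : realType) (u : nat -> C R) (z : C R) :
  u @ \oo --> z -> (fun n => complex.Re (u n)) @ \oo --> (complex.Re z : R).
Proof.
apply: cvg_additive_contraction; last exact: normc_ge_Re.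
by move=> [a b] [c d].
Qed.

Lemma cvg_Im (R : realType) (u : nat -> C R) (z : C R) :
  u @ \oo --> z -> (fun n => complex.Im (u n)) @ \oo --> (complex.Im z : R).
Proof.
apply: cvg_additive_contraction; last exact: normc_ge_Im.
by move=> [a b] [c d].
Qed.

Lemma cvg_complex (R : realType) (u : nat -> C R) (x y : R) :
  (fun n => complex.Re (u n)) @ \oo --> x ->
  (fun n => complex.Im (u n)) @ \oo --> y ->
  u @ \oo --> (x +i* y : C R).
Proof.
move=> ux uy.
have cvg_real (v : nat -> R) (a : R) : v @ \oo --> a ->
    (fun n => (v n)%:C : C R) @ \oo --> (a%:C : C R).
  move=> /cvgrPdist_lt va; apply/cvgrPdist_lt => -[e e'] /=.
  rewrite ltcE /= => /andP[/eqP -> e0].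
  apply: filterS (va _ e0) => n; rewrite -ltcR; congr (_ < _).
  by rewrite -rmorphB normc_def /= expr0n /= addr0 sqrtr_sqr.
have -> : u = (fun n =>
    (complex.Re (u n))%:C + 'i%C * (complex.Im (u n))%:C : C R).
  by apply/funext => n; exact: complexE.
have -> : (x +i* y : C R) = x%:C + 'i%C * y%:C by exact: (complexE (x +i* y)).
by apply: cvgD; [|apply: cvgM (cvg_cst _) _]; exact: cvg_real.
Qed.

(** * Every digit sequence describes a point of the twin dragon *)

Lemma norm_alphaV (R : realType) : `|(alpha R)^-1| = (Num.sqrt 2^-1)%:C.
Proof.
rewrite normfV (normc_def (-1 +i* 1 : R[i])) /= sqrrN expr1n.
by rewrite -fmorphV /= sqrtrV.
Qed.

(** The real and imaginary parts are dominated by a geometric series of ratio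
    |1/alpha| = sqrt (1/2) < 1; working with parts lets completeness of the
    reals be used. *)
Lemma is_cvg_alpha_series (R : realType) (d : nat -> bool) :
  exists z : C R, series (fun k => (d k)%:R * alpha R ^- k.+1) @ \oo --> z.
Proof.
pose u k : C R := (d k)%:R * alpha R ^- k.+1; rewrite -[fun k : nat => _]/u.
pose rho : R := Num.sqrt 2^-1.
have rho1 : rho < 1 by rewrite -sqrtr1 ltr_sqrt// invf_lt1// ltr1n.
have rho0 : 0 <= rho := sqrtr_ge0 _.
have u_le k : `|u k| <= (rho ^+ k.+1)%:C.
  rewrite /u normrM -exprVn normrX norm_alphaV -rmorphXn /=.
  case: (d k); first by rewrite normr1 mul1r.
  by rewrite normr0 mul0r lecR exprn_ge0.
have dominated (v : nat -> R) :
    (forall k, `|v k|%:C <= `|u k|) -> cvgn (series v).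
  move=> vu; apply: normed_cvg.
  apply: (@series_le_cvg _ _ (geometric rho rho)) => [k|k|k|].
  - exact: normr_ge0.
  - by rewrite mulr_ge0 ?exprn_ge0.
  - by rewrite /= -exprS -lecR; exact: le_trans (vu _) (u_le _).
  - by apply: is_cvg_geometric_series; rewrite ger0_norm.
have /dominated/cvg_ex[x ux] : forall k, `|complex.Re (u k)|%:C <= `|u k|.
  by move=> k; exact: normc_ge_Re.
have /dominated/cvg_ex[y uy] : forall k, `|complex.Im (u k)|%:C <= `|u k|.
  by move=> k; exact: normc_ge_Im.
exists (x +i* y); apply: cvg_complex.
- rewrite [X in X @ _ --> _](_ : _ = series (fun k => complex.Re (u k))) //.
  by apply/funext => n; rewrite /series /=
    (raddf_sum (@complex.Re R : Rcomplex R -> R)).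
- rewrite [X in X @ _ --> _](_ : _ = series (fun k => complex.Im (u k))) //.
  by apply/funext => n; rewrite /series /=
    (raddf_sum (@complex.Im R : Rcomplex R -> R)).
Qed.

Lemma alphaX4 (R : realType) : alpha R ^+ 4 = - 4%:R.
Proof.
rewrite !exprS expr0 mulr1 /alpha -(rmorph_nat (real_complex R)); simpc.
by apply/eqP; rewrite eq_complex /=; apply/andP; split; apply/eqP; ring.
Qed.

Lemma digitsP (R : realType) (b : digits R) :
  exists e : {ffun 'I_4 -> bool}, val b = \sum_(j < 4) (e j)%:R * alpha R ^+ j.
Proof.
have := fsvalP b; rewrite !inE => /codomP[e be]; by exists e.
Qed.

(** The base alpha digit e_j of the k-th base -4 digit carries the weight
    alpha^j / alpha^(4(k+1)) = alpha^-(4k + (3-j) + 1), so each block of four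
    digits has to be read backwards. *)
Lemma regroup_series (R : realType) (b : nat -> digits R) :
  exists d : nat -> bool, forall n,
    series (fun k => (d k)%:R * alpha R ^- k.+1) (4 * n)%N =
    series (fun k => val (b k) / (- 4%:R) ^+ k.+1) n.
Proof.
have [e be] := choice (fun k => digitsP (b k)).
pose d k : bool := e (k %/ 4)%N (inord (3 - k %% 4)); exists d.
have a0 : alpha R != 0 by rewrite eq_complex /= oner_eq0 andbF.
have term k (j : 'I_4) : (e k j)%:R * alpha R ^+ j / alpha R ^+ (4 * k.+1) =
    (d (4 * k + rev_ord j)%N)%:R * alpha R ^- (4 * k + rev_ord j).+1.
  rewrite /d !(mulnC 4) divnMDl// (divn_small (ltn_ord _)) addn0.
  rewrite modnMDl (modn_small (ltn_ord _)) /=.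
  have j4 := ltn_ord j.
  have -> : inord (3 - (4 - j.+1)) = j :> 'I_4.
    by rewrite -[RHS]inord_val; congr inord; lia.
  rewrite -mulrA; congr (_ * _).
  have -> : (k.+1 * 4 = j + (k * 4 + (4 - j.+1)).+1)%N by lia.
  by rewrite exprD invfM mulrA divff ?mul1r// expf_neq0.
elim=> [|n IHn]; first by rewrite muln0 /series /= !big_geq.
rewrite [RHS]seriesSr -IHn mulnS addnC 4!addnS addn0 4!seriesSr -!addrA.
congr (_ + _).
rewrite be -alphaX4 -exprM mulr_suml (eq_bigr _ (fun j _ => term n j)).
rewrite (reindex_inj rev_ord_inj) 4!big_ord_recr big_ord0 /=.
rewrite !subSS !subn0 !addnS !addn0.
by rewrite -!addrA; apply/esym/add0r.
Qed.

(** The limit is taken on the base alpha series, where domination gives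
    convergence; the base -4 series is a subsequence of it. *)
Lemma expansion_in_twin_dragon (R : realType) (b : nat -> digits R) :
  exists2 z : C R, is_expansion b z & twin_dragon R z.
Proof.
have [d db] := regroup_series b.
have [z dz] := is_cvg_alpha_series R d.
exists z; last by exists d.
rewrite /is_expansion (_ : series _ =
    series (fun k => (d k)%:R * alpha R ^- k.+1) \o muln 4).
  by apply: cvg_comp dz; exact: cvg_mulnl.
by apply/funext => n; rewrite /= db.
Qed.

(** * Expansions of an integer in base -4 and their remainders *)

(** [remainder x l n] is the value that the tail of the digit sequence [l]
    from rank [n] on must have for the whole sequence to expand [x]. *)
Fixpoint remainder (x : int) (l : nat -> int) (n : nat) : int :=
  if n is n'.+1 then - 4 * remainder x l n' - l n' else x.

Lemma series_remainder (R : realType) (x : int) (l : nat -> int) (n : nat) :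
  series (fun k => (l k)%:~R / (- 4%:R) ^+ k.+1 : R) n =
  x%:~R - (remainder x l n)%:~R / (- 4%:R) ^+ n.
Proof.
elim: n => [|n IHn].
  by rewrite /series /= big_geq // expr0 divr1 subrr.
rewrite seriesSr IHn /= exprS.
have h4 : (- 4%:R) ^+ n != 0 :> R by rewrite expf_neq0 // oppr_eq0 pnatr_eq0.
rewrite !(rmorphB, rmorphM, rmorphN) /=.
by field.
Qed.

(** Once past N, a remainder can no longer be brought back by the digits:
    4 (N + 4^n) - N >= N + 4^(n+1). *)
Lemma remainder_escape (N : nat) (x : int) (l : nat -> int) (m n : nat) :
  (forall k, (`|l k| <= N)%N) -> (N < `|remainder x l m|)%N ->
  (N + 4 ^ n <= `|remainder x l (m + n)|)%N.
Proof.
move=> lN mN; elim: n => [|n IHn]; first by rewrite addn0 addn1.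
rewrite addnS /= expnS; move: (lN (m + n)%N) IHn; lia.
Qed.

(** The n-th partial sum misses [x] by |s_n| / 4^n. Bounded remainders make
    this error tend to 0, while an escaping one keeps it above 4^-m, where m is
    the rank of the escape. *)
Lemma cvg_series_remainder (R : realType) (N : nat) (x : int) (l : nat -> int) :
  (forall k, (`|l k| <= N)%N) ->
  (series (fun k => (l k)%:~R / (- 4%:R) ^+ k.+1 : R) @ \oo --> (x%:~R : R)) <->
  (forall n, (`|remainder x l n| <= N)%N).
Proof.
move=> lN; split=> [lx m|sN].
  rewrite leqNgt; apply/negP => mN.
  have e0 : 0 < (4%:R ^+ m)^-1 :> R by rewrite invr_gt0 exprn_gt0.
  move/cvgrPdist_lt: lx => /(_ _ e0) [n _ /(_ (m + n)%N (leq_addl _ _))].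
  rewrite (series_remainder R x) opprB addrC subrK normrM normfV normrX normrN.
  rewrite (ger0_norm (ler0n _ _)) exprD invfM mulrCA.
  rewrite gtr_pMr ?invr_gt0 ?exprn_gt0//.
  rewrite ltr_pdivrMr ?exprn_gt0// mul1r ltNge => /negP; apply.
  rewrite -intr_norm -abszE -natrX -pmulrn ler_nat.
  exact: leq_trans (leq_addl _ _) (remainder_escape n lN mN).
apply/cvgrPdist_le => /= e e0.
have /cvgrPdist_le /(_ _ e0) : geometric (N%:R : R) 4%:R^-1 @ \oo --> (0 : R).
  by apply: cvg_geometric; rewrite ger0_norm ?invr_ge0// invf_lt1// ltr1n.
apply: filterS => n /=; rewrite sub0r normrN.
apply: le_trans.
rewrite (series_remainder R x) opprB addrC subrK normrM normfV normrX normrN.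
rewrite (ger0_norm (ler0n _ _)) exprVn normrM normfV normrX.
rewrite !(ger0_norm (ler0n _ _)).
rewrite ler_pM2r ?invr_gt0 ?exprn_gt0//.
by rewrite -intr_norm -abszE -pmulrn ler_nat.
Qed.

(** * The linear form of the line on digits *)

Definition linform (R : realType) (p q : int) (z : C R) : R :=
  p%:~R * complex.Re z + q%:~R * complex.Im z.

Lemma linformD (R : realType) p q : {morph @linform R p q : z w / z + w}.
Proof. by move=> [a b] [c d]; rewrite /linform /=; ring. Qed.

Lemma linform0 (R : realType) p q : @linform R p q 0 = 0.
Proof. by rewrite /linform /= !mulr0 addr0. Qed.

Lemma linform_scale (R : realType) p q (z : C R) m :
  linform p q (z / (- 4%:R) ^+ m) = linform p q z / (- 4%:R) ^+ m.
Proof.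
have -> : (- 4%:R) ^+ m = ((- 4%:R) ^+ m)%:C :> C R.
  by rewrite rmorphXn rmorphN rmorph_nat.
rewrite -fmorphV; case: z => x y; rewrite /linform /=; ring.
Qed.

(** Multiplication by alpha turns the linear form of coefficients (p, q) into
    the one of coefficients (q - p, - p - q), so the induction generalizes over
    them. *)
Lemma linform_alphaX (R : realType) p q j :
  linform p q (alpha R ^+ j) \is a Num.int.
Proof.
elim: j p q => [|j IHj] p q.
  by rewrite expr0 /linform /= mulr1 mulr0 addr0 intr_int.
rewrite exprS (_ : linform _ _ _ = linform (q - p) (- p - q) (alpha R ^+ j)) //.
case: (alpha R ^+ j) => x y; rewrite /linform /= !(rmorphB, rmorphN) /=; ring.
Qed.

Lemma linform_digit (R : realType) p q (d : digits R) :
  exists n : int, linform p q (val d) = n%:~R.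
Proof.
apply/intrP; have [e ->] := digitsP d.
rewrite (big_morph _ (linformD p q) (linform0 R p q)); apply: rpred_sum => j _.
case: (e j); first by rewrite mul1r linform_alphaX.
by rewrite mul0r linform0 rpred0.
Qed.

Lemma cvg_linform (R : realType) p q (u : nat -> C R) (z : C R) :
  u @ \oo --> z -> (fun n => linform p q (u n)) @ \oo --> linform p q z.
Proof.
by move=> uz; apply: cvgD; apply: cvgM (cvg_cst _) _;
  [exact: cvg_Re|exact: cvg_Im].
Qed.

Lemma DeltaE (R : realType) p q r (z : C R) :
  Delta R p q r z <-> linform p q z = r%:~R.
Proof.
split=> [[x [y [-> <-]]]//|]; case: z => x y pqr.
by exists x, y.
Qed.

(** * The automaton of remainders *)

(** The integers of [-N, N] are encoded as ordinals by a shift of N. *)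
Definition state_val (N : nat) (s : 'I_(N.*2).+1) : int := (s : nat)%:Z - N%:Z.

Lemma state_val_bound (N : nat) (s : 'I_(N.*2).+1) : (`|state_val s| <= N)%N.
Proof. by rewrite /state_val; move: (ltn_ord s); lia. Qed.

Lemma state_val_inord (N : nat) (x : int) :
  (`|x| <= N)%N -> state_val (inord `|x + N%:Z| : 'I_(N.*2).+1) = x.
Proof. by move=> xN; rewrite /state_val inordK; lia. Qed.

(** Since all states are terminal, the acceptance condition only asks that the
    remainders never leave the set of states. *)
Definition remainder_automaton (A : finType) (N : nat) (r : int)
    (l : A -> int) : buchi A := {|
  state := 'I_(N.*2).+1;
  edges := [set t | state_val t.2 == - 4 * state_val t.1.1 - l t.1.2];
  initial := [set s | state_val s == r];
  terminal := [set: 'I_(N.*2).+1] |}.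

Lemma remainder_automatonP (A : finType) (N : nat) (r : int) (l : A -> int)
    (w : nat -> A) :
  omega_language (remainder_automaton N r l) w <->
  forall n, (`|remainder r (l \o w) n| <= N)%N.
Proof.
split=> [[s [sE sT]] n|wN].
  suff -> : remainder r (l \o w) n = state_val (s n) by exact: state_val_bound.
  elim: n => [|n /= ->]; last by have := sE n; rewrite inE /= => /eqP.
  (* The initial condition is part of every successful prefix, so one
     successful prefix suffices to know where the path starts. *)
  have [m [+ _]] := infinite_setN0 sT.
  by rewrite inE => /eqP.
exists (fun n => inord `|remainder r (l \o w) n + N%:Z|); split=> [n|].
  by rewrite inE /= !state_val_inord//; exact: (wN n.+1).
apply: (sub_infinite_set _ infinite_nat) => n _; rewrite /= /successful_prefix /=.
by rewrite !inE state_val_inord ?eqxx; last exact: (wN 0%N).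
Qed.

(** * The intersection with a line *)

Theorem theorem2p4 (R : realType) (p q r : int) :
  exists M : buchi (digits R),
    omega_language M =
    [set b : nat -> digits R |
      exists2 z : C R, is_expansion b z & (twin_dragon R `&` Delta R p q r) z].
Proof.
have [l lE] := choice (@linform_digit R p q).
pose N := \max_d `|l d|%N.
have lN d : (`|l d| <= N)%N by exact: leq_bigmax.
exists (remainder_automaton N r l); apply/seteqP.
have linform_series (b : nat -> digits R) :
    (fun n => linform p q (series (fun k => val (b k) / (- 4%:R) ^+ k.+1) n)) =
    series (fun k => (l (b k))%:~R / (- 4%:R) ^+ k.+1).
  apply/funext => n; rewrite /series /=.
  rewrite (big_morph _ (linformD p q) (linform0 R p q)).
  by apply: eq_bigr => k _; rewrite linform_scale lE.
split=> b.
  move/remainder_automatonP/(cvg_series_remainder R _ (fun k => lN (b k))).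
  have [z bz zK] := expansion_in_twin_dragon b; exists z => //; split=> //.
  apply/DeltaE; have := @cvg_linform R p q _ z bz; rewrite linform_series => lz.
  exact: cvg_unique lz _.
move=> [z bz [_ /DeltaE zr]]; apply/remainder_automatonP.
apply/(cvg_series_remainder R _ (fun k => lN (b k))).
by rewrite -zr -linform_series; exact: cvg_linform.
Qed.
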